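(* Let $\mathbb{F}$ be a finite field of characteristic $2$ and let $P\in\mathbb{F}[x_1,\dots,x_m]$ be a multilinear polynomial. The following are equivalent: (i) $P$ is representable; (ii) for every $\ell\in\mathbb{F}^m$, $P$ is factorizable modulo $\mathcal{I}(\ell^2)$; (iii) there exists $\ell\in\mathbb{F}^m$ such that $P$ is factorizable modulo $\mathcal{I}(\ell^2)$. Here $\ell^2=(\ell_1^2,\dots,\ell_m^2)$ for $\ell=(\ell_1,\dots,\ell_m)$.
   Context: A polynomial is multilinear if each of its monomials has degree at most $1$ in each variable. A polynomial $P\in\mathbb{F}[x_1,\dots,x_m]$ is representable if there is a symmetric matrix $M$ with all entries in $\mathbb{F}\cup\{x_1,\dots,x_m\}$ with $\det(M)=P$. For $\lambda\in\mathbb{F}^m$, let $\mathcal{I}(\lambda)=\langle x_1^2+\lambda_1,\dots,x_m^2+\lambda_m\rangle$, $\mathcal{R}(\lambda)=\mathbb{F}[x_1,\dots,x_m]/\mathcal{I}(\lambda)$, and $\pi_\lambda$ the canonical projection. An element of $\mathcal{R}(\lambda)$ is linear if it is the projection of a polynomial of total degree at most $1$. $P$ is factorizable modulo $\mathcal{I}(\lambda)$ if $\pi_\lambda(P)=t_1\cdots t_k$ for some linear elements $t_1,\dots,t_k$ of $\mathcal{R}(\lambda)$. *)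

(* Defs.v *)
From HB Require Import structures.
From mathcomp Require Import all_boot all_algebra closed_field.
From mathcomp Require Import boolp mpoly.

Set Implicit Arguments.
Unset Strict Implicit.
Unset Printing Implicit Defensive.

Import GRing.Theory.

Local Open Scope ring_scope.
Local Open Scope quotient_scope.

Definition multilinear (F : fieldType) (m : nat) (P : {mpoly F[m]}) : Prop :=
  forall mon, mon \in msupp P -> forall i : 'I_m, (mon i <= 1)%N.

Definition representable (F : fieldType) (m : nat) (P : {mpoly F[m]}) : Prop :=
  exists (n : nat) (M : 'M[{mpoly F[m]}]_n),
    [/\ M^T = M,
        forall i j, (exists a : F, M i j = a%:MP) \/ (exists k : 'I_m, M i j = 'X_k)
      & \det M = P].

Section Quotient.

(* Countability is only used to have an algebraic closure at hand when proving
   that the ideal below is proper, as the library requires for ring quotients. *)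
Variables (F : countFieldType) (m : nat) (lambda : 'I_m -> F).

Definition sq_ideal : {pred {mpoly F[m]}} :=
  fun f => `[< exists c : 'I_m -> {mpoly F[m]},
                 f = \sum_(i < m) c i * ('X_i ^+ 2 + (lambda i)%:MP) >].

Lemma sq_ideal_closed : idealr_closed sq_ideal.
Proof.
split.
- apply/asboolP; exists (fun=> 0).
  by rewrite big1 // => i _; rewrite mul0r.
- apply/negP => /asboolP [c Hc].
  have [K [f _]] := countable_algebraic_closure F.
  have Hsq i : exists x : K, x ^+ 2 = - f (lambda i).
    have [x Hx] := @solve_monicpoly K 2
      (fun k => if k == 0 then - f (lambda i) else 0) isT.
    exists x; rewrite Hx big_ord_recr big_ord1 /=.
    by rewrite expr0 mulr1 mul0r addr0.
  have [v Hv] := fin_all_exists Hsq.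
  have /eqP := congr1 (mmap f v) Hc.
  rewrite rmorph1 raddf_sum big1 ?oner_eq0 // => i _ /=.
  by rewrite rmorphM rmorphD rmorphXn /= mmapX mmap1U mmapC Hv addNr mulr0.
- move=> a u v /asboolP [cu ->] /asboolP [cv ->]; apply/asboolP.
  exists (fun i => a * cu i + cv i).
  rewrite mulr_sumr -big_split /=; apply: eq_bigr => i _.
  by rewrite mulrDl mulrA.
Qed.

HB.instance Definition _ :=
  isIdealr.Build {mpoly F[m]} sq_ideal sq_ideal_closed.

Local Notation sq_quot := {ideal_quot sq_ideal}.

(* msize is the total degree plus one (and 0 for the zero polynomial). *)
Definition linear_elt (t : sq_quot) : Prop :=
  exists2 p : {mpoly F[m]}, (msize p <= 2)%N & t = \pi_sq_quot p.

Definition factorizable (P : {mpoly F[m]}) : Prop :=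
  exists (k : nat) (t : 'I_k -> sq_quot),
    (forall i, linear_elt (t i)) /\ \pi_sq_quot P = \prod_(i < k) t i.

End Quotient.

(* Main.v *)
Require Import Defs.
From mathcomp Require Import all_boot all_algebra.
From mathcomp Require Import perm fingroup.
From mathcomp Require Import boolp mpoly.

(* In R(l^2) every element squares to the square of its value at l, and in
   characteristic 2 the determinant of a symmetric matrix whose off-diagonal
   entries square to zero is the product of its diagonal entries.

   If P = det M with M symmetric, a congruence over F that diagonalizes the
   form M(l) (after adding a summand 1 to make it non-alternating) turns M into
   a matrix with linear diagonal entries and off-diagonal entries vanishing at l,
   so that det M is a product of linear elements.  Conversely, a product of linear
   elements is, modulo I(l^2), the determinant of a matrix G + B D B^T with G
   symmetric, G and B over F and D = diag(x_1 .. x_m); this is a Schur complement of a symmetric matrix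
   with entries in F and the x_i, each x_i occurring once.  The determinant of
   the latter is multilinear and congruent to P, hence equal to P, because a
   nonzero multilinear polynomial is never in I(l^2). *)

Set Implicit Arguments.
Unset Strict Implicit.
Unset Printing Implicit Defensive.

Import GRing.Theory.
Local Open Scope ring_scope.
Local Open Scope quotient_scope.

(** * Symmetric determinants in characteristic 2 *)

(** Points moved by [h] form pairs [x], [h x] with equal values, which cancel; comparing [enum_rank]
    selects one point of each pair. *)
Lemma sum_involution (V : zmodType) (T : finType) (h : T -> T) (f : T -> V) :
    (forall v : V, v + v = 0) -> involutive h -> (forall x, f (h x) = f x) ->
  \sum_x f x = \sum_(x | h x == x) f x.
Proof.
move=> V2 hK fh; rewrite (bigID (fun x => h x == x)) /= [X in _ + X](_ : _ = 0) ?addr0 //.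
rewrite (bigID (fun x => (enum_rank x < enum_rank (h x))%N)) /=.
rewrite [X in _ + X](reindex_inj (inv_inj hK)) /=.
under [X in _ + X]eq_bigr do rewrite fh.
rewrite [X in _ + X](eq_bigl (fun x => (h x != x) && (enum_rank x < enum_rank (h x))%N)).
  exact: V2.
move=> x; rewrite hK eq_sym; case: eqVneq => //= hx.
by rewrite -leqNgt leq_eqVlt (inj_eq val_inj) (inj_eq enum_rank_inj) eq_sym (negPf hx).
Qed.

(* A permutation and its inverse contribute equal terms, which cancel in
   characteristic 2; an involution other than 1 contributes a square of an
   off-diagonal entry. *)
Lemma det_sym_offdiag_sq0 (R : comNzRingType) (n : nat) (M : 'M[R]_n) :
    2%N \in [pchar R] -> M^T = M ->
    (forall i j, i != j -> M i j ^+ 2 = 0) ->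
  \det M = \prod_i M i i.
Proof.
move=> R2 Msym Moff; have Mji i j : M j i = M i j by rewrite -[in RHS]Msym mxE.
rewrite /determinant (@sum_involution _ _ (fun s : 'S_n => s^-1)%g).
- rewrite (bigD1 1%g) /= ?invg1 ?eqxx // odd_perm1 expr0 mul1r.
  rewrite [X in _ + X]big1 ?addr0; first by apply: eq_bigr => i _; rewrite perm1.
  move=> s /andP [/eqP sV s1].
  have [i si] : exists i, s i != i.
    apply/existsP; apply: contraNT s1; rewrite negb_exists => /forallP s1.
    by apply/eqP/permP => i; rewrite perm1; apply/eqP; rewrite -[_ == _]negbK.
  have ssi : s (s i) = i by rewrite -{1}sV permK.
  rewrite (bigD1 i) //= (bigD1 (s i)) //= ssi Mji mulrA -expr2.
  by rewrite Moff ?mul0r ?mulr0 // eq_sym.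
- exact: addrr_pchar2.
- exact: invgK.
move=> s; rewrite odd_permV; congr (_ * _).
rewrite (reindex_inj (@perm_inj _ s)) /=; apply: eq_bigr => i _.
by rewrite permK Mji.
Qed.

(** * Diagonalization of symmetric forms by congruence *)

Definition congruent_diag (F : fieldType) (n : nat) (A : 'M[F]_n) :=
  exists2 U : 'M[F]_n, U \in unitmx & is_diag_mx (U *m A *m U^T).

Lemma congruent_diag_congr (F : fieldType) (n : nat) (A U : 'M[F]_n) :
  U \in unitmx -> congruent_diag (U *m A *m U^T) -> congruent_diag A.
Proof.
move=> Uu [V Vu dV]; exists (V *m U); first by rewrite unitmx_mul Vu.
by rewrite trmx_mul !mulmxA in dV *.
Qed.

Lemma congruent_diag_block (F : fieldType) (n : nat) (a : 'M[F]_1) (A : 'M[F]_n) :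
  congruent_diag A -> congruent_diag (block_mx a 0 0 A : 'M_(1 + n)).
Proof.
move=> [U Uu dU]; exists (block_mx 1%:M 0 0 U).
  by rewrite unitmxE det_ublock det1 mul1r -unitmxE.
rewrite tr_block_mx !trmx0 !mulmx_block !(mulmx0, mul0mx, addr0, add0r).
by rewrite is_diag_block_mx // !eqxx dU mx11_is_diag.
Qed.

Lemma unitmx_block_lower (F : fieldType) (m n : nat) (A : 'M[F]_(n, m)) :
  (block_mx 1%:M 0 A 1%:M : 'M_(m + n)) \in unitmx.
Proof. by rewrite unitmxE det_lblock !det1 mulr1 unitr1. Qed.

Lemma unitmx_block_upper (F : fieldType) (m n : nat) (A : 'M[F]_(m, n)) :
  (block_mx 1%:M A 0 1%:M : 'M_(m + n)) \in unitmx.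
Proof. by rewrite unitmxE det_ublock !det1 mulr1 unitr1. Qed.

Lemma congruent_diag_schur (F : fieldType) (n : nat) (a : F) (v : 'rV[F]_n)
    (B : 'M[F]_n) :
    a != 0 ->
    congruent_diag (block_mx a%:M 0 0 (B - a^-1 *: (v^T *m v)) : 'M_(1 + n)) ->
  congruent_diag (block_mx a%:M v v^T B : 'M_(1 + n)).
Proof.
move=> a0 dB.
apply: (@congruent_diag_congr _ _ _ (block_mx 1%:M 0 (- a^-1 *: v^T) 1%:M)).
  exact: unitmx_block_lower.
rewrite tr_block_mx !trmx1 trmx0 linearZ /= trmxK.
rewrite !mulmx_block !(mulmx0, mul0mx, mulmx1, mul1mx, addr0, add0r).
rewrite mul_mx_scalar mul_scalar_mx !scalerA mulrN divff // scaleN1r addNr.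
by rewrite scaleN1r addNr mul0mx add0r -scalemxAl scaleNr addrC.
Qed.

(** Replacing the first basis vector e by e + e_i keeps its norm [a], because [C i i = 0], and makes
    it pair with the others through row [i] of [C]. *)
Lemma congruent_diag_add_row (F : fieldType) (n : nat) (a : F) (C : 'M[F]_n)
    (i : 'I_n) :
    C^T = C -> C i i = 0 ->
    congruent_diag (block_mx a%:M (row i C) (row i C)^T C : 'M_(1 + n)) ->
  congruent_diag (block_mx a%:M 0 0 C : 'M_(1 + n)).
Proof.
move=> sC Cii dC.
apply: (@congruent_diag_congr _ _ _ (block_mx 1%:M (delta_mx 0 i) 0 1%:M)).
  exact: unitmx_block_upper.
rewrite tr_block_mx !trmx1 trmx0 trmx_delta.
rewrite !mulmx_block !(mulmx0, mul0mx, mulmx1, mul1mx, addr0, add0r).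
rewrite -rowE -!colE (_ : col i (row i C) = 0) ?addr0.
  by rewrite tr_row sC in dC.
by apply/matrixP => x y; rewrite !mxE.
Qed.

Lemma sym_mxP (R : pzRingType) (n : nat) (A : 'M[R]_n) :
  A^T = A -> forall i j, A j i = A i j.
Proof. by move=> sA i j; rewrite -[in RHS]sA mxE. Qed.

(* Albert: a symmetric bilinear form with an anisotropic vector has an
   orthogonal basis.  When the complement of that vector e is alternating and
   nonzero, say with c = C i j <> 0, the vector e + e_i has the same norm and
   its complement contains a vector of norm - c^2 / a. *)
Lemma sym_congruent_diag (F : fieldType) (n : nat) (A : 'M[F]_n.+1) :
  A^T = A -> A 0 0 != 0 -> congruent_diag A.
Proof.
elim: n A => [|n IHn] A sA a0; first by exists 1%:M; rewrite ?unitmx1 ?mx11_is_diag.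
(* A transposition of the basis moves a nonzero diagonal entry to position 0, as [IHn] requires. *)
have diagP (B : 'M[F]_n.+1) j : B^T = B -> B j j != 0 -> congruent_diag B.
  move=> sB Bj; apply: (@congruent_diag_congr _ _ _ (tperm_mx 0 j)).
    exact: unitmx_perm.
  apply: IHn.
    by rewrite !trmx_mul trmxK sB mulmxA.
  by rewrite -mulmxA tr_tperm_mx -xcolE -xrowE !mxE tpermL.
pose v : 'rV_n.+1 := ursubmx (A : 'M_(1 + n.+1)).
pose B := drsubmx (A : 'M_(1 + n.+1)).
have eul : ulsubmx (A : 'M_(1 + n.+1)) = (A 0 0)%:M.
  by apply/matrixP => i j; rewrite !ord1 !mxE eqxx mulr1n; congr (A _ _); apply: val_inj.
have edl : dlsubmx (A : 'M_(1 + n.+1)) = v^T.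
  by apply/matrixP => i j; rewrite !mxE (sym_mxP sA).
have eA : A = block_mx (A 0 0)%:M v v^T B.
  by rewrite -[LHS](@submxK _ 1 n.+1 1 n.+1) eul edl.
have sB : B^T = B by apply/matrixP => i j; rewrite !mxE (sym_mxP sA).
set a := A 0 0 in a0 eA *.
have schur_sym (a' : F) (w : 'rV_n.+1) (C : 'M_n.+1) : C^T = C ->
    (C - a' *: (w^T *m w))^T = C - a' *: (w^T *m w).
  by move=> sC; rewrite linearB linearZ /= trmx_mul trmxK sC.
pose C := B - a^-1 *: (v^T *m v).
have sC : C^T = C by exact: schur_sym.
rewrite eA; apply: congruent_diag_schur => //; rewrite -/C; clearbody C.
have [/existsP [j Cj]|] := boolP [exists j, C j j != 0].
  exact: congruent_diag_block (diagP _ j sC Cj).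
rewrite negb_exists => /forallP C0; have {}C0 i : C i i = 0.
  by apply/eqP; rewrite -[_ == _]negbK.
have [->|/matrix0Pn [i [j Cij]]] := eqVneq C 0.
  exists 1%:M; rewrite ?unitmx1 // trmx1 mul1mx mulmx1 is_diag_block_mx //.
  by rewrite !eqxx mx11_is_diag mx0_is_diag.
apply: (@congruent_diag_add_row _ _ _ _ i) => //; apply: congruent_diag_schur => //.
apply: congruent_diag_block; apply: (diagP _ j); first exact: schur_sym.
rewrite !mxE big_ord1 !mxE C0 sub0r oppr_eq0 mulf_eq0 invr_eq0 (negPf a0) /=.
by rewrite mulf_eq0 orbb.
Qed.

(** * Multilinear polynomials in the ideal *)

Lemma mpoly_pchar (R : nzRingType) (n p : nat) :
  p \in [pchar R] -> p \in [pchar {mpoly R[n]}].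
Proof. exact: (rmorph_pchar (@mpolyC n R)). Qed.

(* In characteristic 2 the partial derivatives of x_i^2 + l_i^2 vanish, so the
   ideal is closed under differentiation and all its elements vanish at l;
   differentiating along the leading monomial isolates its coefficient. *)
Lemma multilinear_in_sq_ideal_eq0 (F : fieldType) (n : nat) (l : 'I_n -> F)
    (Q : {mpoly F[n]}) (c : 'I_n -> {mpoly F[n]}) :
    2%N \in [pchar F] -> multilinear Q ->
    Q = \sum_(i < n) c i * ('X_i ^+ 2 + (l i ^+ 2)%:MP) ->
  Q = 0.
Proof.
move=> F2 mQ defQ; apply/eqP; apply: contraT => Q0.
pose J (p : {mpoly F[n]}) := exists c : 'I_n -> {mpoly F[n]},
  p = \sum_(i < n) c i * ('X_i ^+ 2 + (l i ^+ 2)%:MP).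
have Jd j p : J p -> J p^`M(j).
  move=> [e ->]; exists (fun i => (e i)^`M(j)); rewrite raddf_sum.
  apply: eq_bigr => i _ /=; rewrite mderivM mderivD mderivC addr0 expr2 mderivM.
  by rewrite [('X_i)^`M(j) * _]mulrC addrr_pchar2 ?mpoly_pchar // mulr0 addr0.
have [e /(congr1 (meval l))] : J Q^`M[mlead Q].
  by rewrite mderivm_foldr; elim: (flatten _) => [|j s IHs]; [exists c | apply: Jd].
rewrite raddf_sum /= big1 => [|i _]; last first.
  by rewrite mevalM mevalD rmorphXn /= mevalXU mevalC (addrr_pchar2 F2) mulr0.
suff -> : Q^`M[mlead Q] = (Q@_(mlead Q))%:MP.
  by rewrite mevalC => /eqP; rewrite mleadc_eq0 (negPf Q0).
apply/mpolyP => g; rewrite mcoeff_mderivm mcoeffC.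
have [->|g0] := eqVneq g 0%MM.
  (* Differentiation multiplies the leading coefficient by factorials of exponents, all equal to 1
     since [Q] is multilinear. *)
  rewrite addm0 mulr1 big1 // => i _; rewrite ffactnn.
  by have := mQ _ (mlead_supp Q0) i; case: (mlead Q i) => [|[]].
rewrite mulr0 mcoeff_gt_mlead ?mul0rn // lt_mdeg_ltmc // mdegD -[ltnLHS]addn0.
by rewrite ltn_add2l lt0n mdeg_eq0.
Qed.

(** * Degree of a determinant in one variable *)

Definition degree_le (R : nzRingType) (n : nat) (k : 'I_n) (d : nat) (p : {mpoly R[n]}) :=
  forall mon, mon \in msupp p -> (mon k <= d)%N.

Lemma degree_leC (R : nzRingType) (n : nat) (k : 'I_n) (d : nat) (a : R) :
  degree_le k d a%:MP.
Proof.
move=> mon; rewrite msuppC; case: ifP => // _; rewrite inE => /eqP ->.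
by rewrite mnm0E.
Qed.

Lemma degree_leX (R : nzRingType) (n : nat) (i k : 'I_n) :
  degree_le k (i == k) ('X_i : {mpoly R[n]}).
Proof. by move=> mon; rewrite msuppX inE => /eqP ->; rewrite mnm1E. Qed.

Lemma degree_leD (R : nzRingType) (n : nat) (k : 'I_n) (d : nat) (p q : {mpoly R[n]}) :
  degree_le k d p -> degree_le k d q -> degree_le k d (p + q).
Proof.
by move=> dp dq mon /msuppD_le; rewrite mem_cat => /orP []; [apply: dp | apply: dq].
Qed.

Lemma degree_leM (R : nzRingType) (n : nat) (k : 'I_n) (d e : nat) (p q : {mpoly R[n]}) :
  degree_le k d p -> degree_le k e q -> degree_le k (d + e) (p * q).
Proof.
move=> dp dq mon /msuppM_le /allpairsP [[m1 m2] /= [/dp le1 /dq le2 ->]].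
by rewrite mnmDE leq_add.
Qed.

(** Each term of the Leibniz expansion takes exactly one entry from row [r], the only row where x_k
    may occur. *)
Lemma degree_le_det (R : comNzRingType) (m n : nat) (k : 'I_m) (r : 'I_n)
    (M : 'M[{mpoly R[m]}]_n) :
    (forall i j, degree_le k (i == r) (M i j)) ->
  degree_le k 1 (\det M).
Proof.
move=> dM; apply: (big_ind (degree_le k 1)) => [||s _].
- by rewrite -mpolyC0; apply: degree_leC.
- exact: degree_leD.
rewrite -[1%N]add0n; apply: degree_leM.
  by rewrite -mpolyC1 -mpolyCN -rmorphXn; apply: degree_leC.
have -> : 1%N = (\sum_(i < n) (i == r))%N.
  by rewrite (bigD1 r) //= eqxx big1 // => i /negPf ->.
apply: (big_ind2 (fun p d => degree_le k d p)) => [|p d q e|//].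
  by rewrite -mpolyC1; apply: degree_leC.
exact: degree_leM.
Qed.

(** * From symmetric determinants to products of linear elements *)

(** Squaring is a ring morphism in characteristic 2, so the two sides need only agree on constants
    and variables. Later [f] is the projection to the quotient. *)
Lemma sqr_meval (F : fieldType) (m : nat) (R : comNzRingType)
    (f : {rmorphism {mpoly F[m]} -> R}) (l : 'I_m -> F) (p : {mpoly F[m]}) :
    2%N \in [pchar F] -> (forall i, f 'X_i ^+ 2 = f (l i ^+ 2)%:MP) ->
  f p ^+ 2 = f (p.@[l] ^+ 2)%:MP.
Proof.
move=> F2 fX; have R2 : 2%N \in [pchar R].
  by apply: (rmorph_pchar f); apply: mpoly_pchar.
have sqrD (S : comNzRingType) (x y : S) :
    2%N \in [pchar S] -> (x + y) ^+ 2 = x ^+ 2 + y ^+ 2.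
  by move=> S2; rewrite sqrrD mulr2n (addrr_pchar2 S2) addr0.
elim/mpolyind: p => [|c mon p _ _ IHp].
  by rewrite meval0 expr0n mpolyC0 rmorph0 expr0n.
rewrite mevalD rmorphD /= !sqrD // mpolyCD rmorphD /= IHp; congr (_ + _).
rewrite -mul_mpolyC mevalM mevalC mevalX mpolyXE_id.
rewrite [in RHS]exprMn mpolyCM !(rmorphM f) /= exprMn; congr (_ * _).
  by rewrite (rmorphXn (@mpolyC m F)) rmorphXn.
rewrite -!prodrXl !rmorph_prod /= -prodrXl; apply: eq_bigr => i _.
rewrite exprAC (rmorphXn (@mpolyC m F)) !rmorphXn /= [LHS]exprAC fX.
by rewrite (rmorphXn (@mpolyC m F)) rmorphXn.
Qed.

Lemma msize_sum_le (R : nzRingType) (n d : nat) (I : finType) (f : I -> {mpoly R[n]}) :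
  (forall i, (msize (f i) <= d)%N) -> (msize (\sum_i f i) <= d)%N.
Proof.
move=> fd; apply: (big_ind (fun p => (msize p <= d)%N)) => // [|p q dp dq].
  by rewrite msize0.
by apply: leq_trans (msizeD_le _ _) _; rewrite geq_max dp.
Qed.

Lemma msize_congr_le (R : comNzRingType) (m n d : nat) (U : 'M[R]_n)
    (M : 'M[{mpoly R[m]}]_n) :
    (forall i j, (msize (M i j) <= d)%N) ->
  let V := map_mx (@mpolyC m R) U in
  forall i j, (msize ((V *m M *m V^T) i j) <= d)%N.
Proof.
move=> Md V i j; rewrite mxE; apply: msize_sum_le => k.
rewrite !mxE mulrC mul_mpolyC; apply: leq_trans (msizeZ_le _ _) _.
apply: msize_sum_le => h.
by rewrite !mxE mul_mpolyC; apply: leq_trans (msizeZ_le _ _) _.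
Qed.

(* Diagonalize the form M(l), stabilized by a 1 so that it has an anisotropic
   vector, by a congruence U over F: then U (1 + M) U^T has linear diagonal
   entries, and its off-diagonal entries vanish at l, hence square to 0. *)
Lemma det_sym_prod_linear (F : fieldType) (m n : nat) (R : comNzRingType)
    (f : {rmorphism {mpoly F[m]} -> R}) (l : 'I_m -> F) (M : 'M[{mpoly F[m]}]_n) :
    2%N \in [pchar F] -> (forall i, f 'X_i ^+ 2 = f (l i ^+ 2)%:MP) ->
    M^T = M -> (forall i j, (msize (M i j) <= 2)%N) ->
  exists k (t : 'I_k -> {mpoly F[m]}),
    (forall i, (msize (t i) <= 2)%N) /\ f (\det M) = \prod_i f (t i).
Proof.
move=> F2 fX sM M2; have R2 : 2%N \in [pchar R].
  by apply: (rmorph_pchar f); apply: mpoly_pchar.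
pose M1 : 'M_(1 + n) := block_mx 1%:M 0 0 M.
have sM1 : M1^T = M1 by rewrite tr_block_mx !trmx0 trmx1 sM.
have [||U Uu /is_diag_mxP dU] := @sym_congruent_diag F n (map_mx (meval l) M1).
- by rewrite map_trmx sM1.
- have -> : 0 = @lshift 1 n 0 :> 'I_n.+1 by apply: val_inj.
  by rewrite mxE block_mxEul mxE eqxx rmorph1 oner_neq0.
pose C := map_mx (@mpolyC m F) U; pose N := C *m M1 *m C^T.
have sN : N^T = N by rewrite !trmx_mul trmxK sM1 mulmxA.
have dN : \det N = (\det U ^+ 2)%:MP * \det M.
  have -> : \det M = \det M1 by rewrite det_ublock det1 mul1r.
  rewrite !det_mulmx det_tr det_map_mx mulrAC.
  by rewrite (rmorphXn (@mpolyC m F)) expr2.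
have M12 (i j : 'I_(1 + n)) : (msize (M1 i j) <= 2)%N.
  rewrite -[i]splitK -[j]splitK; case: (split i) => i'; case: (split j) => j' /=.
  - by rewrite block_mxEul mxE; case: eqP; rewrite ?mulr1n ?mulr0n ?msize1 ?msize0.
  - by rewrite block_mxEur mxE msize0.
  - by rewrite block_mxEdl mxE msize0.
  - by rewrite block_mxEdr.
have N2 i : (msize (N i i) <= 2)%N by exact: msize_congr_le.
have N0 i j : i != j -> (N i j).@[l] = 0.
  move=> ij; have := dU i j ij.
  have -> : U = map_mx (meval l) C by apply/matrixP => x y; rewrite !mxE mevalC.
  by rewrite map_trmx -!map_mxM mxE.
(* The extra constant factor cancels the [\det U ^+ 2] of [dN]. *)
pose t (i : 'I_(1 + n).+1) :=
  if unlift ord0 i is Some j then N j j else ((\det U)^-2)%:MP.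
exists (1 + n).+1, t; split=> [i|].
  rewrite /t; case: unliftP => [j _|_]; first exact: N2.
  by rewrite msizeC; case: eqP.
rewrite big_ord_recl /t unlift_none.
under eq_bigr do rewrite liftK.
have <- : \det (map_mx f N) = \prod_i f (N i i).
  rewrite det_sym_offdiag_sq0 ?map_trmx ?sN // => [|i j ij].
    by apply: eq_bigr => i _; rewrite mxE.
  by rewrite mxE (sqr_meval (l := l)) // N0 // expr0n rmorph0.
rewrite det_map_mx dN -rmorphM /= mulrA -mpolyCM mulVf ?mul1r //.
by rewrite expf_neq0 // -unitfE -unitmxE.
Qed.

(** * From products of linear elements to symmetric determinants *)

Lemma mpoly_linearE (R : comNzRingType) (n : nat) (p : {mpoly R[n]}) :
  (msize p <= 2)%N -> p = (p@_0)%:MP + \sum_(i < n) p@_U_(i) *: 'X_i.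
Proof.
move=> p2; apply/mpolyP => g; rewrite mcoeffD mcoeffC raddf_sum /=.
under eq_bigr do rewrite mcoeffZ mcoeffX.
have [->|g0] := eqVneq g 0%MM.
  by rewrite mulr1 big1 ?addr0 // => i _; rewrite mnm1_eq0 mulr0.
rewrite mulr0 add0r; have [/mdeg1P [i /eqP ->]|g1] := boolP (mdeg g == 1%N).
  rewrite (bigD1 i) //= eqxx mulr1 big1 ?addr0 // => j /negPf ji.
  by rewrite eq_mnm1 ji mulr0.
rewrite big1 => [|i _]; last first.
  by case: (U_(i)%MM =P g) g1 => [<-|]; rewrite ?mdeg1 // mulr0.
apply: memN_msupp_eq0; apply: msize_mdeg_ge; apply: leq_trans p2 _.
by move: g0 g1; rewrite -mdeg_eq0; case: (mdeg g) => [|[|]].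
Qed.

(** Adding the second block row to the first, then the first to the second, gives a block upper
    triangular matrix with identity diagonal blocks. *)
Lemma det_antidiag1 (R : comNzRingType) (n : nat) (D : 'M[R]_n) :
  2%N \in [pchar R] -> \det (block_mx 0 1%:M 1%:M D) = 1.
Proof.
move=> R2; have addmm (A : 'M[R]_n) : A + A = 0.
  by apply/matrixP => i j; rewrite !mxE (addrr_pchar2 R2).
have := congr1 determinant
  (mulmx_block 1%:M 0 1%:M 1%:M (1%:M : 'M_n) (1%:M + D) 1%:M D).
have := congr1 determinant
  (mulmx_block 1%:M 1%:M 0 1%:M (0 : 'M_n) (1%:M : 'M_n) 1%:M D).
rewrite !(mul1mx, mul0mx, mulmx1, mulmx0, add0r, addr0) !det_mulmx.
rewrite !det_ublock !det_lblock !det1 !mul1r => -> ->.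
by rewrite addmm -addrA addmm addr0 det_ublock !det1 mulr1.
Qed.

(** The lower right block has inverse [block_mx (- D) 1%:M 1%:M 0], so its Schur complement is
    [G + B *m D *m B^T]. *)
Lemma det_schur_linearized (R : comNzRingType) (k n : nat) (G : 'M[R]_k)
    (B : 'M[R]_(k, n)) (D : 'M[R]_n) :
    2%N \in [pchar R] ->
  \det (block_mx G (row_mx B 0) (col_mx B^T 0) (block_mx 0 1%:M 1%:M D))
  = \det (G + B *m D *m B^T).
Proof.
move=> R2; have := congr1 determinant (mulmx_block G (row_mx B 0) (col_mx B^T 0)
  (block_mx 0 1%:M 1%:M D) 1%:M 0 (col_mx (D *m B^T) (- B^T)) 1%:M).
rewrite det_mulmx det_lblock !det1 !mulr1 => ->.
rewrite mul_row_col mul_block_col !(mul1mx, mul0mx, mulmx1, mulmx0, add0r, addr0).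
rewrite mulmxN subrr -[X in block_mx _ _ X _]/(_ + _) add_col_mx subrr addr0 col_mx0.
by rewrite det_ublock det_antidiag1 // mulr1 mulmxA.
Qed.

(** The Frobenius map is injective, hence bijective on a finite field. *)
Lemma finField_sqrt (F : finFieldType) :
  2%N \in [pchar F] -> exists s : F -> F, forall a, s a ^+ 2 = a.
Proof.
move=> F2; have [s _ sK] := injF_bij (fmorph_inj (pFrobenius_aut F2)).
by exists s.
Qed.

(* Write L_j = g_j + \sum_i b_ji^2 x_i and let B = (b_ji), D = diag(x_1 .. x_m).
   The matrix G + B D B^T has diagonal entries L_j when G has diagonal g_j, and
   the off-diagonal entries of G can be chosen so that it is diagonal at l; it
   is the Schur complement of a matrix in which each x_i occurs only once. *)
Lemma prod_linear_det_sym (F : fieldType) (m k : nat) (R : comNzRingType)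
    (f : {rmorphism {mpoly F[m]} -> R}) (l : 'I_m -> F) (s : F -> F)
    (L : 'I_k -> {mpoly F[m]}) :
    2%N \in [pchar F] -> (forall i, f 'X_i ^+ 2 = f (l i ^+ 2)%:MP) ->
    (forall a, s a ^+ 2 = a) -> (forall j, (msize (L j) <= 2)%N) ->
  exists n (N : 'M[{mpoly F[m]}]_n),
    [/\ N^T = N,
        forall i j, (exists a : F, N i j = a%:MP) \/ (exists h : 'I_m, N i j = 'X_h),
        multilinear (\det N)
      & f (\det N) = \prod_j f (L j)].
Proof.
move=> F2 fX sK L2; have R2 : 2%N \in [pchar R].
  by apply: (rmorph_pchar f); apply: mpoly_pchar.
pose b j i := s ((L j)@_U_(i)).
(* Off the diagonal this is the value of [B *m D *m B^T] at [l], so that the two cancel there. *)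
pose g i j := if i == j then (L i)@_0 else \sum_h b i h * b j h * l h.
pose B : 'M[{mpoly F[m]}]_(k, m) := \matrix_(j, i) (b j i)%:MP.
pose G : 'M[{mpoly F[m]}]_k := \matrix_(i, j) (g i j)%:MP.
pose D : 'M[{mpoly F[m]}]_m := diag_mx (\row_i 'X_i).
have sG : G^T = G.
  apply/matrixP => i j; rewrite !mxE /g eq_sym; case: eqP => [->//|_].
  by congr _%:MP; apply: eq_bigr => h _; rewrite [b j h * _]mulrC.
have KE i j : (G + B *m D *m B^T) i j = (g i j)%:MP + \sum_h (b i h * b j h) *: 'X_h.
  rewrite mxE [G i j]mxE mxE; congr (_ + _); apply: eq_bigr => h _.
  by rewrite mul_mx_diag !mxE mulrAC -mpolyCM mul_mpolyC.
exists (k + (m + m))%N, (block_mx G (row_mx B 0) (col_mx B^T 0) (block_mx 0 1%:M 1%:M D)).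
split=> [|i j|mon monN h|].
- by rewrite !tr_block_mx tr_row_mx tr_col_mx trmxK !trmx0 trmx1 tr_diag_mx sG.
- rewrite -[i]splitK -[j]splitK; case: (split i) => {}i; case: (split j) => {}j /=.
  + by rewrite block_mxEul mxE; left; exists (g i j).
  + rewrite block_mxEur -[j]splitK; case: (split j) => {}j /=.
      by rewrite row_mxEl mxE; left; exists (b i j).
    by rewrite row_mxEr mxE; left; exists 0.
  + rewrite block_mxEdl -[i]splitK; case: (split i) => {}i /=.
      by rewrite col_mxEu !mxE; left; exists (b j i).
    by rewrite col_mxEd mxE; left; exists 0.
  rewrite block_mxEdr -[i]splitK -[j]splitK.
  case: (split i) => {}i; case: (split j) => {}j /=.
  + by rewrite block_mxEul mxE; left; exists 0.
  + by rewrite block_mxEur mxE; left; exists (i == j)%:R; rewrite mpolyC_nat.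
  + by rewrite block_mxEdl mxE; left; exists (i == j)%:R; rewrite mpolyC_nat.
  rewrite block_mxEdr !mxE; case: (i == j); first by right; exists i.
  by left; exists 0.
(* The variable x_h occurs only in the block [D], in this row. *)
- apply: (degree_le_det (r := rshift k (rshift m h))) monN => {mon} i j.
  rewrite -[i]splitK -[j]splitK; case: (split i) => {}i; case: (split j) => {}j /=.
  + by rewrite block_mxEul mxE; apply: degree_leC.
  + rewrite block_mxEur -[j]splitK; case: (split j) => {}j /=.
      by rewrite row_mxEl mxE; apply: degree_leC.
    by rewrite row_mxEr mxE -mpolyC0; apply: degree_leC.
  + rewrite block_mxEdl -[i]splitK; case: (split i) => {}i /=.
      by rewrite col_mxEu !mxE; apply: degree_leC.
    by rewrite col_mxEd mxE -mpolyC0; apply: degree_leC.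
  rewrite block_mxEdr -[i]splitK -[j]splitK.
  case: (split i) => {}i; case: (split j) => {}j /=.
  + by rewrite block_mxEul mxE -mpolyC0; apply: degree_leC.
  + by rewrite block_mxEur mxE -mpolyC_nat; apply: degree_leC.
  + by rewrite block_mxEdl mxE -mpolyC_nat; apply: degree_leC.
  rewrite block_mxEdr !mxE !(inj_eq (@rshift_inj _ _)); case: (i == j).
    exact: degree_leX.
  by rewrite mulr0n -mpolyC0; apply: degree_leC.
rewrite det_schur_linearized ?mpoly_pchar // -det_map_mx det_sym_offdiag_sq0 //.
- apply: eq_bigr => j _; rewrite mxE KE /g eqxx; congr (f _).
  rewrite [RHS]mpoly_linearE //; congr (_ + _).
  by apply: eq_bigr => h _; rewrite -expr2 sK.
- by rewrite map_trmx linearD /= !trmx_mul trmxK tr_diag_mx sG mulmxA.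
move=> i j ij; rewrite mxE (sqr_meval (l := l)) // KE mevalD mevalC raddf_sum /=.
under [X in _ + X]eq_bigr do rewrite mevalZ mevalXU.
by rewrite /g (negPf ij) (addrr_pchar2 F2) expr0n rmorph0.
Qed.

(** * The equivalence, in the quotient ring *)

Local Notation sq_quot l := {ideal_quot (@sq_ideal _ _ (fun i => l i ^+ 2))}.

(** In characteristic 2 the generator x_i^2 + l_i^2 is also x_i^2 - l_i^2. *)
Lemma pi_sqrX (F : countFieldType) (m : nat) (l : 'I_m -> F) (i : 'I_m) :
  2%N \in [pchar F] ->
  \pi_(sq_quot l) 'X_i ^+ 2 = \pi_(sq_quot l) (l i ^+ 2)%:MP.
Proof.
move=> F2; rewrite -rmorphXn /=; apply/eqP; rewrite -Quotient.idealrBE.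
apply/asboolP; exists (fun j => (j == i)%:R).
rewrite (bigD1 i) //= eqxx mul1r big1 ?addr0; last by move=> j /negPf ->; rewrite mul0r.
by rewrite -[in RHS](oppr_pchar2 (mpoly_pchar _ F2) (_ %:MP)).
Qed.

Lemma representable_factorizable (F : countFieldType) (m : nat) (l : 'I_m -> F)
    (P : {mpoly F[m]}) :
    2%N \in [pchar F] -> representable P -> factorizable (fun i => l i ^+ 2) P.
Proof.
move=> F2 [n [M [sM entM <-]]].
have [||k [t [t2 defP]]] :=
  @det_sym_prod_linear F m n (sq_quot l) (\pi_(sq_quot l)) l M F2 _ sM.
- by move=> i; apply: pi_sqrX.
- move=> i j; case: (entM i j) => [[a ->]|[h ->]]; last by rewrite msizeX mdeg1.
  by rewrite msizeC; case: eqP.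
exists k, (fun i => \pi_(sq_quot l) (t i)); split=> // i; by exists (t i).
Qed.

Lemma factorizable_representable (F : finFieldType) (m : nat) (l : 'I_m -> F)
    (P : {mpoly F[m]}) :
    2%N \in [pchar F] -> multilinear P -> factorizable (fun i => l i ^+ 2) P ->
  representable P.
Proof.
move=> F2 mP [k [t [lin_t defP]]]; have [s sK] := finField_sqrt F2.
have [L L2 tL] : exists2 L : 'I_k -> {mpoly F[m]},
    forall j, (msize (L j) <= 2)%N & forall j, t j = \pi_(sq_quot l) (L j).
  have /fin_all_exists2 [L L2 tL] j : exists2 p : {mpoly F[m]},
      (msize p <= 2)%N & t j = \pi_(sq_quot l) p by exact: lin_t.
  by exists L.
have [|n [N [sN entN mN detN]]] :=
  @prod_linear_det_sym F m k (sq_quot l) (\pi_(sq_quot l)) l s L F2 _ sK L2.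
  by move=> i; apply: pi_sqrX.
exists n, N; split=> //; apply/eqP; rewrite -subr_eq0; apply/eqP.
have /asboolP [c defQ] : \det N - P \in @sq_ideal F m (fun i => l i ^+ 2).
  rewrite Quotient.idealrBE; apply/eqP; rewrite detN defP.
  by apply: eq_bigr => j _; rewrite tL.
apply: multilinear_in_sq_ideal_eq0 F2 _ defQ => mon /msuppB_le.
by rewrite mem_cat => /orP []; [apply: mN | apply: mP].
Qed.

Theorem theorem4p10 (F : finFieldType) (charF : 2%N \in [pchar F]) (m : nat)
    (P : {mpoly F[m]}) (multP : multilinear P) :
  (representable P <->
     (forall l : 'I_m -> F, factorizable (fun i => l i ^+ 2) P)) /\
  ((forall l : 'I_m -> F, factorizable (fun i => l i ^+ 2) P) <->
     (exists l : 'I_m -> F, factorizable (fun i => l i ^+ 2) P)).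
Proof.
have rep_fact : representable P ->
    forall l : 'I_m -> F, factorizable (fun i => l i ^+ 2) P.
  by move=> repP l; apply: representable_factorizable.
(* Condition (ii) is used at the point 0; (iii) leads back to (ii) through (i). *)
split; split=> //.
- by move=> /(_ (fun=> 0)); apply: factorizable_representable.
- by move=> factP; exists (fun=> 0).
by move=> [l factP]; apply: rep_fact; apply: factorizable_representable factP.
Qed.
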